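(* For every session type $T$ let $[\![T]\!]=\{P\mid \vdash P:T\}$ be the set of closed processes typable with $T$ in the empty environment. Then for all session types $T,T'$: $T\leqslant T'$ if and only if $[\![T]\!]\subseteq[\![T']\!]$.
   Context: Expressions: $e::=x\mid v\mid \mathsf{succ}\,e\mid \mathsf{neg}\,e\mid \neg e\mid e_1\oplus e_2\mid e_1>e_2$, where values $v$ are natural numbers $n$, integers $i$, and $\mathsf{true},\mathsf{false}$. Processes: $P::=\mathsf p?\ell(x).P\mid \mathsf p!\ell(e).P\mid P+P\mid \mathsf{if}\ e\ \mathsf{then}\ P\ \mathsf{else}\ P\mid \mu X.P\mid X\mid \mathbf 0$ ($\mathsf p$ participants, $\ell$ labels, $X$ process variables; recursion guarded, $\mu X.P$ identified with its unfolding). $\sum_{i\in I}P_i$ denotes iterated $+$. Sorts $S::=\mathtt{nat}\mid\mathtt{int}\mid\mathtt{bool}$; subsorting $\leq:$ is the reflexive-transitive closure of $\mathtt{nat}\leq:\mathtt{int}$. Session types: $T::=\bigwedge_{i\in I}\mathsf p?\ell_i(S_i).T_i\mid\bigvee_{i\in I}\mathsf q!\ell_i(S_i).T_i\mid\mu\mathbf t.T\mid\mathbf t\mid\mathtt{end}$, with pairwise distinct labels in each intersection/union, guarded recursion, types with the same regular tree identified. Subtyping $\leqslant$ is the greatest relation on session types closed under: $\mathtt{end}\leqslant\mathtt{end}$; $\bigwedge_{i\in I\cup J}\mathsf p?\ell_i(S_i).T_i\leqslant\bigwedge_{i\in I}\mathsf p?\ell_i(S'_i).T'_i$ if for all $i\in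 I$: $S'_i\leq:S_i$ and $T_i\leqslant T'_i$; $\bigvee_{i\in I}\mathsf p!\ell_i(S_i).T_i\leqslant\bigvee_{i\in I\cup J}\mathsf p!\ell_i(S'_i).T'_i$ if for all $i\in I$: $S_i\leq:S'_i$ and $T_i\leqslant T'_i$. Typing: environments $\Gamma$ map expression variables to sorts and process variables to session types. Expressions: $\Gamma\vdash n:\mathtt{nat}$, $\Gamma\vdash i:\mathtt{int}$, $\Gamma\vdash\mathsf{true},\mathsf{false}:\mathtt{bool}$, $\Gamma,x:S\vdash x:S$; $\mathsf{succ}\,e:\mathtt{nat}$ if $e:\mathtt{nat}$; $\mathsf{neg}\,e:\mathtt{int}$ if $e:\mathtt{int}$; $\neg e:\mathtt{bool}$ if $e:\mathtt{bool}$; $e_1\oplus e_2:S$ if $e_1,e_2:S$; $e_1>e_2:\mathtt{bool}$ if $e_1,e_2:\mathtt{int}$; $e:S'$ if $e:S$ and $S\leq:S'$. Processes: if $\Gamma,x:S_i\vdash P_i:T_i$ for all $i\in I$ then $\Gamma\vdash\sum_{i\in I}\mathsf q?\ell_i(x).P_i:\bigwedge_{i\in I}\mathsf q?\ell_i(S_i).T_i$; $\Gamma\vdash\mathbf 0:\mathtt{end}$; if $\Gamma\vdash e:S$ and $\Gamma\vdash P:T$ then $\Gamma\vdash\mathsf q!\ell(e).P:\mathsf q!\ell(S).T$; if $\Gamma\vdash e:\mathtt{bool}$, $\Gamma\vdash P_1:T_1$, $\Gamma\vdash P_2:T_2$ then $\Gamma\vdash\mathsf{if}\ e\ \mathsf{then}\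 P_1\ \mathsf{else}\ P_2:T_1\vee T_2$; if $\Gamma,X:T\vdash P:T$ then $\Gamma\vdash\mu X.P:T$; $\Gamma,X:T\vdash X:T$; if $\Gamma\vdash P:T$ and $T\leqslant T'$ then $\Gamma\vdash P:T'$ (conclusions must be well-formed session types). *)

(* Defs.v *)
(* Stdlib only. All binders are de Bruijn indices: expression variables are
   bound by inputs, process variables by [PMu], type variables by [TMu]. *)
From Stdlib Require Import List ZArith Relations.
Import ListNotations.

(* Participants and labels range over countably infinite sets of names. *)
Definition participant := nat.
Definition label := nat.

Inductive value : Type :=
| VNat (n : nat)
| VInt (i : Z)
| VBool (b : bool).

Inductive expr : Type :=
| EVar (x : nat)
| EVal (v : value)
| ESucc (e : expr)
| ENeg (e : expr)
| ENot (e : expr)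
| EChoice (e1 e2 : expr)     (* e1 (+) e2 *)
| EGt (e1 e2 : expr).

Inductive proc : Type :=
| PIn (p : participant) (l : label) (P : proc)            (* binds one expression variable *)
| POut (p : participant) (l : label) (e : expr) (P : proc)
| PPlus (P Q : proc)
| PIf (e : expr) (P Q : proc)
| PMu (P : proc)                                          (* binds one process variable *)
| PVar (X : nat)
| PNil.

Definition up_ren (f : nat -> nat) (n : nat) : nat :=
  match n with 0 => 0 | S m => S (f m) end.

Fixpoint expr_ren (f : nat -> nat) (e : expr) : expr :=
  match e with
  | EVar x => EVar (f x)
  | EVal v => EVal v
  | ESucc e => ESucc (expr_ren f e)
  | ENeg e => ENeg (expr_ren f e)
  | ENot e => ENot (expr_ren f e)
  | EChoice e1 e2 => EChoice (expr_ren f e1) (expr_ren f e2)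
  | EGt e1 e2 => EGt (expr_ren f e1) (expr_ren f e2)
  end.

(* [f] acts on expression variables, [g] on process variables. *)
Fixpoint proc_ren (f g : nat -> nat) (P : proc) : proc :=
  match P with
  | PIn p l P => PIn p l (proc_ren (up_ren f) g P)
  | POut p l e P => POut p l (expr_ren f e) (proc_ren f g P)
  | PPlus P Q => PPlus (proc_ren f g P) (proc_ren f g Q)
  | PIf e P Q => PIf (expr_ren f e) (proc_ren f g P) (proc_ren f g Q)
  | PMu P => PMu (proc_ren f (up_ren g) P)
  | PVar X => PVar (g X)
  | PNil => PNil
  end.

Definition up_proc (s : nat -> proc) (X : nat) : proc :=
  match X with 0 => PVar 0 | S Y => proc_ren (fun x => x) S (s Y) end.

(* Capture-avoiding simultaneous substitution of process variables. *)
Fixpoint proc_subst (s : nat -> proc) (P : proc) : proc :=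
  match P with
  | PIn p l P => PIn p l (proc_subst (fun X => proc_ren S (fun Y => Y) (s X)) P)
  | POut p l e P => POut p l e (proc_subst s P)
  | PPlus P Q => PPlus (proc_subst s P) (proc_subst s Q)
  | PIf e P Q => PIf e (proc_subst s P) (proc_subst s Q)
  | PMu P => PMu (proc_subst (up_proc s) P)
  | PVar X => s X
  | PNil => PNil
  end.

(* P{mu X.P / X} *)
Definition proc_unfold (P : proc) : proc :=
  proc_subst (fun X => match X with 0 => PMu P | S Y => PVar Y end) P.

(* The identification of mu X.P with its unfolding: the least congruence
   containing it. *)
Inductive proc_eq : proc -> proc -> Prop :=
| peq_unfold P : proc_eq (PMu P) (proc_unfold P)
| peq_refl P : proc_eq P P
| peq_sym P Q : proc_eq P Q -> proc_eq Q P
| peq_trans P Q R : proc_eq P Q -> proc_eq Q R -> proc_eq P R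
| peq_in p l P P' : proc_eq P P' -> proc_eq (PIn p l P) (PIn p l P')
| peq_out p l e P P' : proc_eq P P' -> proc_eq (POut p l e P) (POut p l e P')
| peq_plus P P' Q Q' :
    proc_eq P P' -> proc_eq Q Q' -> proc_eq (PPlus P Q) (PPlus P' Q')
| peq_if e P P' Q Q' :
    proc_eq P P' -> proc_eq Q Q' -> proc_eq (PIf e P Q) (PIf e P' Q')
| peq_mu P P' : proc_eq P P' -> proc_eq (PMu P) (PMu P').

(* Every occurrence of the process variable [X] is under an input or output
   prefix. *)
Fixpoint proc_guards (X : nat) (P : proc) : Prop :=
  match P with
  | PIn _ _ _ | POut _ _ _ _ | PNil => True
  | PPlus P Q | PIf _ P Q => proc_guards X P /\ proc_guards X Q
  | PMu P => proc_guards (S X) P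
  | PVar Y => Y <> X
  end.

Fixpoint expr_scoped (m : nat) (e : expr) : Prop :=
  match e with
  | EVar x => x < m
  | EVal _ => True
  | ESucc e | ENeg e | ENot e => expr_scoped m e
  | EChoice e1 e2 | EGt e1 e2 => expr_scoped m e1 /\ expr_scoped m e2
  end.

(* At most [m] free expression variables, at most [k] free process variables,
   and all recursion guarded. *)
Fixpoint proc_wf (m k : nat) (P : proc) : Prop :=
  match P with
  | PIn _ _ P => proc_wf (S m) k P
  | POut _ _ e P => expr_scoped m e /\ proc_wf m k P
  | PPlus P Q => proc_wf m k P /\ proc_wf m k Q
  | PIf e P Q => expr_scoped m e /\ proc_wf m k P /\ proc_wf m k Q
  | PMu P => proc_guards 0 P /\ proc_wf m (S k) P
  | PVar X => X < k
  | PNil => True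
  end.

Definition closed_process (P : proc) : Prop := proc_wf 0 0 P.

(* [is_sum P Ps]: P is an iterated sum, with any bracketing, whose summands
   are Ps; Ps is nonempty. *)
Inductive is_sum : proc -> list proc -> Prop :=
| is_sum_one P : is_sum P [P]
| is_sum_plus P Q Ps Qs :
    is_sum P Ps -> is_sum Q Qs -> is_sum (PPlus P Q) (Ps ++ Qs).

Inductive sort : Type := SNat | SInt | SBool.

Inductive sort_step : sort -> sort -> Prop :=
| nat_int : sort_step SNat SInt.

Definition subsort : sort -> sort -> Prop := clos_refl_trans sort sort_step.

(* An entry (l, S, T) of a branch list is the branch l(S).T. *)
Inductive stype : Type :=
| TEnd
| TIn (p : participant) (bs : list (label * sort * stype))    (* intersection *)
| TOut (p : participant) (bs : list (label * sort * stype))   (* union *)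
| TMu (T : stype)
| TVar (t : nat).

Definition branches := list (label * sort * stype).

Definition labels (bs : branches) : list label := map (fun b => fst (fst b)) bs.

Fixpoint type_ren (f : nat -> nat) (T : stype) : stype :=
  match T with
  | TEnd => TEnd
  | TIn p bs => TIn p (map (fun b => (fst b, type_ren f (snd b))) bs)
  | TOut p bs => TOut p (map (fun b => (fst b, type_ren f (snd b))) bs)
  | TMu T => TMu (type_ren (up_ren f) T)
  | TVar t => TVar (f t)
  end.

Definition up_type (s : nat -> stype) (t : nat) : stype :=
  match t with 0 => TVar 0 | S u => type_ren S (s u) end.

Fixpoint type_subst (s : nat -> stype) (T : stype) : stype :=
  match T with
  | TEnd => TEnd
  | TIn p bs => TIn p (map (fun b => (fst b, type_subst s (snd b))) bs)
  | TOut p bs => TOut p (map (fun b => (fst b, type_subst s (snd b))) bs)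
  | TMu T => TMu (type_subst (up_type s) T)
  | TVar t => s t
  end.

(* T{mu t.T / t} *)
Definition type_unfold (T : stype) : stype :=
  type_subst (fun t => match t with 0 => TMu T | S u => TVar u end) T.

Fixpoint type_guards (t : nat) (T : stype) : Prop :=
  match T with
  | TEnd | TIn _ _ | TOut _ _ => True
  | TMu T => type_guards (S t) T
  | TVar u => u <> t
  end.

(* Index sets of intersections and unions are nonempty. *)
Definition branches_ok (bs : branches) : Prop := bs <> [] /\ NoDup (labels bs).

Inductive type_wf : nat -> stype -> Prop :=
| wf_end k : type_wf k TEnd
| wf_in k p bs :
    branches_ok bs -> (forall l S T, In (l, S, T) bs -> type_wf k T) ->
    type_wf k (TIn p bs)
| wf_out k p bs :
    branches_ok bs -> (forall l S T, In (l, S, T) bs -> type_wf k T) ->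
    type_wf k (TOut p bs)
| wf_mu k T : type_guards 0 T -> type_wf (S k) T -> type_wf k (TMu T)
| wf_var k t : t < k -> type_wf k (TVar t).

Definition session_type (T : stype) : Prop := type_wf 0 T.

(* [type_head T U]: unfolding the leading mu's of T gives U, which exposes the
   root of the tree of T. *)
Inductive type_head : stype -> stype -> Prop :=
| head_end : type_head TEnd TEnd
| head_in p bs : type_head (TIn p bs) (TIn p bs)
| head_out p bs : type_head (TOut p bs) (TOut p bs)
| head_mu T U : type_head (type_unfold T) U -> type_head (TMu T) U.

Definition branches_incl (R : stype -> stype -> Prop) (bs bs' : branches) : Prop :=
  forall l S T, In (l, S, T) bs -> exists T', In (l, S, T') bs' /\ R T T'.

(* Equality of the regular trees of two types, branches being unordered: this
   is the identification of types. *)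
CoInductive type_eq : stype -> stype -> Prop :=
| teq_end T T' : type_head T TEnd -> type_head T' TEnd -> type_eq T T'
| teq_in T T' p bs bs' :
    type_head T (TIn p bs) -> type_head T' (TIn p bs') ->
    branches_incl type_eq bs bs' ->
    branches_incl (fun U' U => type_eq U U') bs' bs ->
    type_eq T T'
| teq_out T T' p bs bs' :
    type_head T (TOut p bs) -> type_head T' (TOut p bs') ->
    branches_incl type_eq bs bs' ->
    branches_incl (fun U' U => type_eq U U') bs' bs ->
    type_eq T T'.

(* As types are identified with their trees, the rules are read at the roots. *)
CoInductive subtype : stype -> stype -> Prop :=
| sub_end T T' : type_head T TEnd -> type_head T' TEnd -> subtype T T'
| sub_in T T' p bs bs' :
    type_head T (TIn p bs) -> type_head T' (TIn p bs') ->
    (forall l S' U', In (l, S', U') bs' ->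
       exists S U, In (l, S, U) bs /\ subsort S' S /\ subtype U U') ->
    subtype T T'
| sub_out T T' p bs bs' :
    type_head T (TOut p bs) -> type_head T' (TOut p bs') ->
    (forall l S U, In (l, S, U) bs ->
       exists S' U', In (l, S', U') bs' /\ subsort S S' /\ subtype U U') ->
    subtype T T'.

(* [type_union T1 T2 T]: T is T1 \/ T2. Union is idempotent (on every type,
   including end and intersections) and otherwise joins two unions of outputs
   to the same participant. When T is a session type, labels common to T1 and
   T2 must therefore carry the same sort and the same continuation. *)
Inductive type_union (T1 T2 T : stype) : Prop :=
| union_idem : type_eq T1 T2 -> type_eq T1 T -> type_union T1 T2 T
| union_out p bs1 bs2 :
    type_head T1 (TOut p bs1) -> type_head T2 (TOut p bs2) ->
    type_eq (TOut p (bs1 ++ bs2)) T -> type_union T1 T2 T.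

Inductive expr_typing (G : list sort) : expr -> sort -> Prop :=
| et_nat n : expr_typing G (EVal (VNat n)) SNat
| et_int i : expr_typing G (EVal (VInt i)) SInt
| et_bool b : expr_typing G (EVal (VBool b)) SBool
| et_var x S : nth_error G x = Some S -> expr_typing G (EVar x) S
| et_succ e : expr_typing G e SNat -> expr_typing G (ESucc e) SNat
| et_neg e : expr_typing G e SInt -> expr_typing G (ENeg e) SInt
| et_not e : expr_typing G e SBool -> expr_typing G (ENot e) SBool
| et_choice e1 e2 S :
    expr_typing G e1 S -> expr_typing G e2 S -> expr_typing G (EChoice e1 e2) S
| et_gt e1 e2 :
    expr_typing G e1 SInt -> expr_typing G e2 SInt -> expr_typing G (EGt e1 e2) SBool
| et_sub e S S' : expr_typing G e S -> subsort S S' -> expr_typing G e S'.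

(* The environment is split into the sorts [G] of the expression variables and
   the session types [D] of the process variables. In [pt_in], an entry
   (l, S, P, T) of the family [I] stands for the summand q?l(x).P and the
   branch l(S).T. The rule [pt_eq] makes the judgement one about processes up
   to the identification of recursive processes with their unfoldings. *)
Inductive typing : list sort -> list stype -> proc -> stype -> Prop :=
| pt_in G D q (I : list (label * sort * proc * stype)) Q :
    is_sum Q (map (fun '(l, _, P, _) => PIn q l P) I) ->
    (forall l S P T, In (l, S, P, T) I -> typing (S :: G) D P T) ->
    session_type (TIn q (map (fun '(l, s, _, T) => (l, s, T)) I)) ->
    typing G D Q (TIn q (map (fun '(l, s, _, T) => (l, s, T)) I))
| pt_nil G D : typing G D PNil TEnd
| pt_out G D q l e P S T :
    expr_typing G e S -> typing G D P T ->
    typing G D (POut q l e P) (TOut q [(l, S, T)])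
| pt_if G D e P1 P2 T1 T2 T :
    expr_typing G e SBool -> typing G D P1 T1 -> typing G D P2 T2 ->
    type_union T1 T2 T -> session_type T ->
    typing G D (PIf e P1 P2) T
| pt_mu G D P T :
    session_type T -> typing G (T :: D) P T -> typing G D (PMu P) T
| pt_var G D X T : nth_error D X = Some T -> typing G D (PVar X) T
| pt_sub G D P T T' :
    typing G D P T -> subtype T T' -> session_type T' -> typing G D P T'
| pt_eq G D P Q T : proc_eq P Q -> typing G D P T -> typing G D Q T.

(* [[T]] *)
Definition denotation (T : stype) (P : proc) : Prop :=
  closed_process P /\ typing [] [] P T.

(* Main.v *)
(* Only "inclusion implies subtyping" needs work. Each session type T has a
   characteristic process [char T], of which T is the least type: an input tests
   the received variable with an operator that pins down its sort, an output
   sends a value whose least sort is the declared one, and a union becomes a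
   nested conditional. If [[T]] is included in [[T']] then [char T] has type T',
   and the pairs (T, T') such that [char T] has type T' satisfy the closure
   conditions defining subtyping. Checking these conditions means inverting
   typing derivations, which may fold and unfold recursions anywhere; but the
   process exposed by unfolding the leading recursions is invariant, up to
   congruence of its components, so typing can be inverted there. *)
From Stdlib Require Import List ZArith Relations Lia.
Require Import Defs.
Import ListNotations.

(** * Substitution in session types *)

Lemma stype_nested_ind (P : stype -> Prop) :
  P TEnd ->
  (forall p bs, (forall b, In b bs -> P (snd b)) -> P (TIn p bs)) ->
  (forall p bs, (forall b, In b bs -> P (snd b)) -> P (TOut p bs)) ->
  (forall T, P T -> P (TMu T)) ->
  (forall t, P (TVar t)) ->
  forall T, P T.
Proof.
  intros Pend Pin Pout Pmu Pvar.
  fix IH 1. intros [|p bs|p bs|T|t].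
  - exact Pend.
  - apply Pin. induction bs as [|c bs IHbs]; [intros b []|].
    intros b [<-|Hb]; [apply IH|exact (IHbs b Hb)].
  - apply Pout. induction bs as [|c bs IHbs]; [intros b []|].
    intros b [<-|Hb]; [apply IH|exact (IHbs b Hb)].
  - apply Pmu, IH.
  - apply Pvar.
Qed.

Lemma map_branches_ext (f g : label * sort * stype -> stype) (bs : branches) :
  (forall b, In b bs -> f b = g b) ->
  map (fun b => (fst b, f b)) bs = map (fun b => (fst b, g b)) bs.
Proof. intros Hfg. apply map_ext_in. intros b Hb. now rewrite Hfg. Qed.

Lemma map_branches_id (f : label * sort * stype -> stype) (bs : branches) :
  (forall b, In b bs -> f b = snd b) -> map (fun b => (fst b, f b)) bs = bs.
Proof.
  intros Hf. rewrite <- (map_id bs) at 2. apply map_ext_in.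
  intros [ls T] Hb. rewrite Hf; auto.
Qed.

Lemma type_ren_ext f g T : (forall t, f t = g t) -> type_ren f T = type_ren g T.
Proof.
  revert f g.
  induction T as [|p bs IH|p bs IH|T IH|t] using stype_nested_ind;
    intros f g Hfg; simpl; f_equal; auto using map_branches_ext.
  apply IH. intros [|t]; simpl; auto.
Qed.

Lemma type_subst_ext sigma tau T :
  (forall t, sigma t = tau t) -> type_subst sigma T = type_subst tau T.
Proof.
  revert sigma tau.
  induction T as [|p bs IH|p bs IH|T IH|t] using stype_nested_ind;
    intros sigma tau Hst; simpl; f_equal; auto using map_branches_ext.
  apply IH. intros [|t]; simpl; congruence.
Qed.

Lemma type_ren_id f T : (forall t, f t = t) -> type_ren f T = T.
Proof.
  revert f.
  induction T as [|p bs IH|p bs IH|T IH|t] using stype_nested_ind;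
    intros f Hf; simpl; f_equal; auto using map_branches_id.
  apply IH. intros [|t]; simpl; auto.
Qed.

Lemma type_subst_id sigma T : (forall t, sigma t = TVar t) -> type_subst sigma T = T.
Proof.
  revert sigma.
  induction T as [|p bs IH|p bs IH|T IH|t] using stype_nested_ind;
    intros sigma Hs; simpl; f_equal; auto using map_branches_id.
  apply IH. intros [|t]; simpl; [reflexivity|now rewrite Hs].
Qed.

Lemma type_ren_ren f g T : type_ren f (type_ren g T) = type_ren (fun t => f (g t)) T.
Proof.
  revert f g.
  induction T as [|p bs IH|p bs IH|T IH|t] using stype_nested_ind;
    intros f g; simpl; f_equal; rewrite ?map_map; simpl; auto using map_branches_ext.
  rewrite IH. apply type_ren_ext. now intros [|t].
Qed.

(* Every exchange law between renaming and substitution is an instance of this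
   square. *)
Lemma type_ren_subst f g sigma tau T :
  (forall t, tau (g t) = type_ren f (sigma t)) ->
  type_ren f (type_subst sigma T) = type_subst tau (type_ren g T).
Proof.
  revert f g sigma tau.
  induction T as [|p bs IH|p bs IH|T IH|t] using stype_nested_ind;
    intros f g sigma tau Hsquare; simpl; rewrite ?map_map; simpl; f_equal;
    auto using map_branches_ext.
  apply IH. intros [|t]; simpl; [reflexivity|].
  rewrite Hsquare, !type_ren_ren. now apply type_ren_ext.
Qed.

Lemma type_subst_subst sigma tau T :
  type_subst tau (type_subst sigma T) = type_subst (fun t => type_subst tau (sigma t)) T.
Proof.
  revert sigma tau.
  induction T as [|p bs IH|p bs IH|T IH|t] using stype_nested_ind;
    intros sigma tau; simpl; f_equal; rewrite ?map_map; simpl; auto using map_branches_ext.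
  rewrite IH. apply type_subst_ext. intros [|t]; simpl; [reflexivity|].
  symmetry. now apply type_ren_subst.
Qed.

Lemma type_subst_ren sigma g T :
  type_subst sigma (type_ren g T) = type_subst (fun t => sigma (g t)) T.
Proof.
  rewrite <- (type_ren_id (fun t => t) (type_subst (fun t => sigma (g t)) T)) by reflexivity.
  symmetry. apply type_ren_subst. intros t. now rewrite type_ren_id.
Qed.

Lemma type_unfold_subst_up sigma T :
  type_unfold (type_subst (up_type sigma) T) =
  type_subst (fun t => match t with 0 => TMu (type_subst (up_type sigma) T) | S u => sigma u end) T.
Proof.
  unfold type_unfold at 1. rewrite type_subst_subst. apply type_subst_ext.
  intros [|t]; simpl; [reflexivity|].
  rewrite type_subst_ren. now apply type_subst_id.
Qed.

Lemma type_guards_ren f t T :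
  (forall u, f u = t -> type_guards u T) -> type_guards t (type_ren f T).
Proof.
  revert f t.
  induction T as [|p bs _|p bs _|T IH|v] using stype_nested_ind; intros f t Hf; simpl; auto.
  - apply IH. intros [|u] E; simpl in E; [discriminate|]. apply (Hf u). now injection E.
  - intros E. exact (Hf v E eq_refl).
Qed.

Lemma type_guards_subst sigma t T :
  (forall u, type_guards u T \/ type_guards t (sigma u)) ->
  type_guards t (type_subst sigma T).
Proof.
  revert sigma t.
  induction T as [|p bs _|p bs _|T IH|v] using stype_nested_ind; intros sigma t Hs; simpl; auto.
  - apply IH. intros [|u]; simpl; [now right|].
    destruct (Hs u) as [HT|Hu]; [now left|right].
    apply type_guards_ren. intros w E. now injection E as ->.
  - destruct (Hs v) as [Hv|Hv]; [now elim Hv|exact Hv].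
Qed.

(** * Well-formed types and their roots *)

Definition branches_wf (k : nat) (bs : branches) : Prop :=
  branches_ok bs /\ forall b, In b bs -> type_wf k (snd b).

Lemma type_wf_in k p bs : type_wf k (TIn p bs) <-> branches_wf k bs.
Proof.
  split.
  - intros Hwf. inversion Hwf; subst. split; [assumption|]. intros [[l s] T]. simpl. eauto.
  - intros [Hok Hbs]. constructor; [exact Hok|]. intros l s T Hb. exact (Hbs _ Hb).
Qed.

Lemma type_wf_out k p bs : type_wf k (TOut p bs) <-> branches_wf k bs.
Proof.
  split.
  - intros Hwf. inversion Hwf; subst. split; [assumption|]. intros [[l s] T]. simpl. eauto.
  - intros [Hok Hbs]. constructor; [exact Hok|]. intros l s T Hb. exact (Hbs _ Hb).
Qed.

Lemma branches_wf_map (f : label * sort * stype -> stype) k j bs :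
  (forall b, In b bs -> type_wf k (snd b) -> type_wf j (f b)) ->
  branches_wf k bs -> branches_wf j (map (fun b => (fst b, f b)) bs).
Proof.
  intros Hf [[Hne Hnd] Hbs]. split; [split|].
  - intros E. now apply map_eq_nil in E.
  - unfold labels in *. now rewrite map_map.
  - intros b Hb. apply in_map_iff in Hb. destruct Hb as [c [<- Hc]]. simpl. auto.
Qed.

Lemma type_wf_ren f k j T :
  (forall t, t < k -> f t < j) -> type_wf k T -> type_wf j (type_ren f T).
Proof.
  revert f k j.
  induction T as [|p bs IH|p bs IH|T IH|u] using stype_nested_ind; intros f k j Hf HT; simpl.
  - constructor.
  - apply type_wf_in in HT. apply type_wf_in. eapply branches_wf_map; eauto.
  - apply type_wf_out in HT. apply type_wf_out. eapply branches_wf_map; eauto.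
  - inversion HT as [| | |? ? Hguarded HT'|]; subst. constructor.
    + apply type_guards_ren. intros [|u] E; [exact Hguarded|discriminate].
    + apply (IH _ (S k)); [|exact HT'].
      intros [|t] Ht; simpl; [lia|]. specialize (Hf t). lia.
  - inversion HT; subst. constructor. auto.
Qed.

Lemma type_wf_subst sigma k j T :
  (forall t, t < k -> type_wf j (sigma t)) -> type_wf k T -> type_wf j (type_subst sigma T).
Proof.
  revert sigma k j.
  induction T as [|p bs IH|p bs IH|T IH|u] using stype_nested_ind; intros sigma k j Hs HT; simpl.
  - constructor.
  - apply type_wf_in in HT. apply type_wf_in. eapply branches_wf_map; eauto.
  - apply type_wf_out in HT. apply type_wf_out. eapply branches_wf_map; eauto.
  - inversion HT as [| | |? ? Hguarded HT'|]; subst. constructor.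
    + apply type_guards_subst. intros [|u]; [now left|right].
      apply type_guards_ren. discriminate.
    + apply (IH _ (S k)); [|exact HT'].
      intros [|t] Ht; simpl; [constructor; lia|].
      apply (type_wf_ren _ j); [lia|apply Hs; lia].
  - inversion HT; subst. auto.
Qed.

Lemma type_wf_unfold k T : type_wf k (TMu T) -> type_wf k (type_unfold T).
Proof.
  intros Hmu. inversion Hmu as [| | |? ? _ HT|]; subst.
  apply (type_wf_subst _ (S k)); [|exact HT].
  intros [|t] Ht; [exact Hmu|]. constructor. lia.
Qed.

Lemma session_type_in p bs l s T : session_type (TIn p bs) -> In (l, s, T) bs -> session_type T.
Proof. intros Hwf Hb. apply type_wf_in in Hwf. exact (proj2 Hwf _ Hb). Qed.

Lemma session_type_out p bs l s T : session_type (TOut p bs) -> In (l, s, T) bs -> session_type T.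
Proof. intros Hwf Hb. apply type_wf_out in Hwf. exact (proj2 Hwf _ Hb). Qed.

Lemma session_type_head T U : type_head T U -> session_type T -> session_type U.
Proof. induction 1; auto. intros HT. now apply IHtype_head, type_wf_unfold. Qed.

Lemma type_head_det T U U' : type_head T U -> type_head T U' -> U = U'.
Proof.
  intros HU. revert U'. induction HU; intros U' HU'; inversion HU'; subst; auto.
Qed.

Lemma type_head_root T U :
  type_head T U -> match U with TEnd | TIn _ _ | TOut _ _ => True | TMu _ | TVar _ => False end.
Proof. now induction 1. Qed.

Fixpoint leading_mus (T : stype) : nat :=
  match T with TMu T => S (leading_mus T) | _ => 0 end.

Lemma leading_mus_ren f T : leading_mus (type_ren f T) = leading_mus T.
Proof. revert f. induction T using stype_nested_ind; intros f; simpl; auto. Qed.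

Lemma leading_mus_subst sigma T :
  (forall t, type_guards t T \/ leading_mus (sigma t) = 0) ->
  leading_mus (type_subst sigma T) = leading_mus T.
Proof.
  revert sigma.
  induction T as [|p bs _|p bs _|T IH|u] using stype_nested_ind; intros sigma Hs; simpl; auto.
  - f_equal. apply IH. intros [|t]; simpl; [now right|].
    rewrite leading_mus_ren. apply Hs.
  - destruct (Hs u) as [Hu|Hu]; [now elim Hu|exact Hu].
Qed.

Lemma type_head_exists T : session_type T -> exists U, type_head T U.
Proof.
  remember (leading_mus T) as n eqn:Hn. revert T Hn.
  induction n as [|n IH]; intros [|p bs|p bs|T|t] Hn HT; try discriminate;
    try (eexists; constructor; fail).
  - inversion HT. lia.
  - destruct (IH (type_unfold T)) as [U HU].
    + injection Hn as ->. symmetry. apply leading_mus_subst. inversion HT; subst.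
      intros [|t]; [now left|now right].
    + now apply type_wf_unfold.
    + exists U. now constructor.
Qed.

(** * Type equality and subtyping *)

Lemma type_eq_same_head T T' U :
  session_type U -> type_head T U -> type_head T' U -> type_eq T T'.
Proof.
  revert T T' U. cofix CIH. intros T T' U HU HT HT'.
  pose proof (type_head_root _ _ HT) as Hroot.
  destruct U as [|p bs|p bs|U|t]; try contradiction.
  - now apply teq_end.
  - apply (teq_in _ _ p bs bs HT HT'); intros l s V Hb; exists V; (split; [exact Hb|]);
      pose proof (session_type_in _ _ _ _ _ HU Hb) as HV;
      destruct (type_head_exists V HV) as [W HW];
      exact (CIH V V W (session_type_head _ _ HW HV) HW HW).
  - apply (teq_out _ _ p bs bs HT HT'); intros l s V Hb; exists V; (split; [exact Hb|]);
      pose proof (session_type_out _ _ _ _ _ HU Hb) as HV;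
      destruct (type_head_exists V HV) as [W HW];
      exact (CIH V V W (session_type_head _ _ HW HV) HW HW).
Qed.

Lemma type_eq_refl T : session_type T -> type_eq T T.
Proof.
  intros HT. destruct (type_head_exists T HT) as [U HU].
  eauto using type_eq_same_head, session_type_head.
Qed.

Lemma type_eq_unfold T : session_type (TMu T) -> type_eq (type_unfold T) (TMu T).
Proof.
  intros HT. destruct (type_head_exists _ HT) as [U HU].
  inversion HU; subst. eauto using type_eq_same_head, session_type_head.
Qed.

Lemma type_eq_sym T T' : type_eq T T' -> type_eq T' T.
Proof.
  revert T T'. cofix CIH.
  intros T T' [? ? HT HT'|? ? p bs bs' HT HT' Hbs Hbs'|? ? p bs bs' HT HT' Hbs Hbs'].
  - now apply teq_end.
  - apply (teq_in _ _ p bs' bs HT' HT); intros l s U Hb;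
      [destruct (Hbs' l s U Hb) as [U' [Hb' HU]]|destruct (Hbs l s U Hb) as [U' [Hb' HU]]];
      exists U'; (split; [exact Hb'|exact (CIH _ _ HU)]).
  - apply (teq_out _ _ p bs' bs HT' HT); intros l s U Hb;
      [destruct (Hbs' l s U Hb) as [U' [Hb' HU]]|destruct (Hbs l s U Hb) as [U' [Hb' HU]]];
      exists U'; (split; [exact Hb'|exact (CIH _ _ HU)]).
Qed.

Lemma subsort_refl s : subsort s s.
Proof. apply rt_refl. Qed.

Lemma subsort_trans s1 s2 s3 : subsort s1 s2 -> subsort s2 s3 -> subsort s1 s3.
Proof. apply rt_trans. Qed.

Variant root_subtype (R : stype -> stype -> Prop) : stype -> stype -> Prop :=
| root_end : root_subtype R TEnd TEnd
| root_in p bs bs' :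
    (forall l s' U', In (l, s', U') bs' ->
       exists s U, In (l, s, U) bs /\ subsort s' s /\ R U U') ->
    root_subtype R (TIn p bs) (TIn p bs')
| root_out p bs bs' :
    (forall l s U, In (l, s, U) bs ->
       exists s' U', In (l, s', U') bs' /\ subsort s s' /\ R U U') ->
    root_subtype R (TOut p bs) (TOut p bs').

Lemma subtype_coind (R : stype -> stype -> Prop) :
  (forall T T', R T T' ->
     exists U U', type_head T U /\ type_head T' U' /\ root_subtype R U U') ->
  forall T T', R T T' -> subtype T T'.
Proof.
  intros HR. cofix CIH. intros T T' HTT'.
  destruct (HR _ _ HTT') as [U [U' [HU [HU' Hroot]]]].
  destruct Hroot as [|p bs bs' Hbs|p bs bs' Hbs].
  - now apply sub_end.
  - apply (sub_in _ _ p bs bs' HU HU'). intros l s' V' Hb.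
    destruct (Hbs l s' V' Hb) as [s [V [HV [Hs HVV']]]].
    exists s, V. split; [exact HV|split; [exact Hs|exact (CIH _ _ HVV')]].
  - apply (sub_out _ _ p bs bs' HU HU'). intros l s V Hb.
    destruct (Hbs l s V Hb) as [s' [V' [HV' [Hs HVV']]]].
    exists s', V'. split; [exact HV'|split; [exact Hs|exact (CIH _ _ HVV')]].
Qed.

Lemma subtype_heads T T' :
  subtype T T' -> exists U U', type_head T U /\ type_head T' U' /\ root_subtype subtype U U'.
Proof. destruct 1; do 2 eexists; repeat (split; [eassumption|]); now constructor. Qed.

Lemma subtype_root T T' U :
  subtype T T' -> type_head T U -> exists U', type_head T' U' /\ root_subtype subtype U U'.
Proof.
  intros Hsub HU. destruct (subtype_heads _ _ Hsub) as [V [U' [HV [HU' Hroot]]]].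
  rewrite (type_head_det _ _ _ HU HV). eauto.
Qed.

Lemma subtype_trans T1 T2 T3 : subtype T1 T2 -> subtype T2 T3 -> subtype T1 T3.
Proof.
  intros H12 H23.
  apply (subtype_coind (fun T1 T3 => exists T2, subtype T1 T2 /\ subtype T2 T3)); [|eauto].
  clear. intros T1 T3 [T2 [H12 H23]].
  destruct (subtype_heads _ _ H12) as [U1 [U2 [HU1 [HU2 Hroot12]]]].
  destruct (subtype_root _ _ _ H23 HU2) as [U3 [HU3 Hroot23]].
  exists U1, U3. split; [exact HU1|split; [exact HU3|]].
  destruct Hroot12 as [|p bs1 bs2 Hbs12|p bs1 bs2 Hbs12];
    inversion Hroot23 as [|? ? bs3 Hbs23|? ? bs3 Hbs23]; subst; constructor.
  - intros l s3 V3 HV3. destruct (Hbs23 _ _ _ HV3) as [s2 [V2 [HV2 [Hs23 HV23]]]].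
    destruct (Hbs12 _ _ _ HV2) as [s1 [V1 [HV1 [Hs12 HV12]]]].
    eauto 9 using subsort_trans.
  - intros l s1 V1 HV1. destruct (Hbs12 _ _ _ HV1) as [s2 [V2 [HV2 [Hs12 HV12]]]].
    destruct (Hbs23 _ _ _ HV2) as [s3 [V3 [HV3 [Hs23 HV23]]]].
    eauto 9 using subsort_trans.
Qed.

Lemma type_eq_subtype T T' : type_eq T T' -> subtype T T'.
Proof.
  apply subtype_coind. clear.
  intros T T' [? ? HT HT'|? ? p bs bs' HT HT' _ Hbs|? ? p bs bs' HT HT' Hbs _];
    do 2 eexists; (split; [exact HT|split; [exact HT'|constructor]]).
  - intros l s U' HU'. destruct (Hbs _ _ _ HU') as [U [HU HUU']].
    eauto 6 using subsort_refl.
  - intros l s U HU. destruct (Hbs _ _ _ HU) as [U' [HU' HUU']].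
    eauto 6 using subsort_refl.
Qed.

Lemma subtype_out_incl T T' p bs bs' :
  type_head T (TOut p bs) -> incl bs bs' -> subtype (TOut p bs') T' -> subtype T T'.
Proof.
  intros HT Hincl Hsub.
  destruct (subtype_root _ _ _ Hsub (head_out p bs')) as [U' [HU' Hroot]].
  inversion Hroot as [| |? ? cs Hcs]; subst. apply (sub_out _ _ p bs cs HT HU'). auto.
Qed.

Lemma type_union_subtype T1 T2 T : type_union T1 T2 T -> subtype T1 T /\ subtype T2 T.
Proof.
  intros [E12 E1T|p bs1 bs2 HT1 HT2 ET].
  - split; [now apply type_eq_subtype|].
    apply (subtype_trans _ T1); apply type_eq_subtype; [now apply type_eq_sym|exact E1T].
  - apply type_eq_subtype in ET.
    split; [apply (subtype_out_incl _ _ p bs1 (bs1 ++ bs2))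
           |apply (subtype_out_incl _ _ p bs2 (bs1 ++ bs2))];
      auto using incl_appl, incl_appr, incl_refl.
Qed.

(** * Substitution in processes *)

Lemma expr_ren_ext f g e : (forall x, f x = g x) -> expr_ren f e = expr_ren g e.
Proof. intros Hfg. induction e; simpl; congruence. Qed.

Lemma expr_ren_ren f g e : expr_ren f (expr_ren g e) = expr_ren (fun x => f (g x)) e.
Proof. induction e; simpl; congruence. Qed.

Lemma expr_ren_id f e : (forall x, f x = x) -> expr_ren f e = e.
Proof. intros Hf. induction e; simpl; congruence. Qed.

Lemma up_ren_ext f g : (forall x, f x = g x) -> forall x, up_ren f x = up_ren g x.
Proof. intros Hfg [|x]; simpl; auto. Qed.

Lemma up_ren_id f : (forall x, f x = x) -> forall x, up_ren f x = x.
Proof. intros Hf [|x]; simpl; auto. Qed.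

Lemma proc_ren_ext f f' g g' P :
  (forall x, f x = f' x) -> (forall X, g X = g' X) -> proc_ren f g P = proc_ren f' g' P.
Proof.
  revert f f' g g'. induction P; intros f f' g g' Hf Hg; simpl; f_equal;
    auto using expr_ren_ext, up_ren_ext.
Qed.

Lemma proc_ren_id f g P :
  (forall x, f x = x) -> (forall X, g X = X) -> proc_ren f g P = P.
Proof.
  revert f g. induction P; intros f g Hf Hg; simpl; f_equal; auto using expr_ren_id, up_ren_id.
Qed.

Lemma proc_ren_ren f f' g g' P :
  proc_ren f' g' (proc_ren f g P) = proc_ren (fun x => f' (f x)) (fun X => g' (g X)) P.
Proof.
  revert f f' g g'. induction P; intros f f' g g'; simpl; f_equal; auto using expr_ren_ren;
    rewrite IHP; apply proc_ren_ext; now intros [|x].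
Qed.

Definition up_input (sigma : nat -> proc) (X : nat) : proc :=
  proc_ren S (fun Y => Y) (sigma X).

Lemma proc_subst_ext sigma tau P :
  (forall X, sigma X = tau X) -> proc_subst sigma P = proc_subst tau P.
Proof.
  revert sigma tau. induction P; intros sigma tau Hst; simpl; f_equal; auto; apply IHP.
  - intros X. now rewrite Hst.
  - intros [|X]; simpl; [reflexivity|now rewrite Hst].
Qed.

Lemma proc_subst_id sigma P : (forall X, sigma X = PVar X) -> proc_subst sigma P = P.
Proof.
  revert sigma. induction P; intros sigma Hs; simpl; f_equal; auto; apply IHP.
  - intros X. now rewrite Hs.
  - intros [|X]; simpl; [reflexivity|now rewrite Hs].
Qed.

Lemma proc_ren_subst f g g' sigma tau P :
  (forall X, tau (g' X) = proc_ren f g (sigma X)) ->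
  proc_ren f g (proc_subst sigma P) = proc_subst tau (proc_ren f g' P).
Proof.
  revert f g g' sigma tau.
  induction P; intros f g g' sigma tau Hsquare; simpl; f_equal; auto; apply IHP.
  - intros Y. rewrite Hsquare, !proc_ren_ren. now apply proc_ren_ext.
  - intros [|Y]; simpl; [reflexivity|].
    rewrite Hsquare, !proc_ren_ren. now apply proc_ren_ext.
Qed.

Lemma proc_subst_ren sigma g P :
  proc_subst sigma (proc_ren (fun x => x) g P) = proc_subst (fun X => sigma (g X)) P.
Proof.
  rewrite <- (proc_ren_id (fun x => x) (fun X => X) (proc_subst (fun X => sigma (g X)) P))
    by reflexivity.
  symmetry. apply proc_ren_subst. intros X. now rewrite proc_ren_id.
Qed.

Lemma proc_subst_subst sigma tau P :
  proc_subst tau (proc_subst sigma P) = proc_subst (fun X => proc_subst tau (sigma X)) P.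
Proof.
  revert sigma tau. induction P; intros sigma tau; simpl; f_equal; auto; rewrite IHP;
    apply proc_subst_ext.
  - intros X. symmetry. now apply proc_ren_subst.
  - intros [|X]; simpl; [reflexivity|]. symmetry. now apply proc_ren_subst.
Qed.

Definition unfolding (P : proc) (X : nat) : proc :=
  match X with 0 => PMu P | S Y => PVar Y end.

Lemma proc_ren_unfolding f g P Q :
  proc_ren f g (proc_subst (unfolding P) Q) =
  proc_subst (unfolding (proc_ren f (up_ren g) P)) (proc_ren f (up_ren g) Q).
Proof. apply proc_ren_subst. now intros [|X]. Qed.

Lemma proc_subst_unfolding sigma P Q :
  proc_subst sigma (proc_subst (unfolding P) Q) =
  proc_subst (unfolding (proc_subst (up_proc sigma) P)) (proc_subst (up_proc sigma) Q).
Proof.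
  rewrite !proc_subst_subst. apply proc_subst_ext.
  intros [|X]; simpl; [reflexivity|].
  rewrite proc_subst_ren. symmetry. now apply proc_subst_id.
Qed.

Lemma proc_eq_ren f g P Q : proc_eq P Q -> proc_eq (proc_ren f g P) (proc_ren f g Q).
Proof.
  intros E. revert f g. induction E; intros f g; simpl; eauto using proc_eq.
  change (proc_unfold P) with (proc_subst (unfolding P) P).
  rewrite proc_ren_unfolding. apply peq_unfold.
Qed.

Lemma proc_eq_up_input sigma tau :
  (forall X, proc_eq (sigma X) (tau X)) -> forall X, proc_eq (up_input sigma X) (up_input tau X).
Proof. intros Hst X. apply proc_eq_ren, Hst. Qed.

Lemma proc_eq_up_proc sigma tau :
  (forall X, proc_eq (sigma X) (tau X)) -> forall X, proc_eq (up_proc sigma X) (up_proc tau X).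
Proof. intros Hst [|X]; [apply peq_refl|apply proc_eq_ren, Hst]. Qed.

Lemma proc_eq_subst_l sigma P Q :
  proc_eq P Q -> proc_eq (proc_subst sigma P) (proc_subst sigma Q).
Proof.
  intros E. revert sigma. induction E; intros sigma; simpl; eauto using proc_eq.
  change (proc_unfold P) with (proc_subst (unfolding P) P).
  rewrite proc_subst_unfolding. apply peq_unfold.
Qed.

Lemma proc_eq_subst_r sigma tau P :
  (forall X, proc_eq (sigma X) (tau X)) -> proc_eq (proc_subst sigma P) (proc_subst tau P).
Proof.
  revert sigma tau. induction P; intros sigma tau Hst; simpl;
    auto using peq_out, peq_plus, peq_if, peq_refl.
  - apply peq_in, IHP, proc_eq_up_input, Hst.
  - apply peq_mu, IHP, proc_eq_up_proc, Hst.
Qed.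

Lemma proc_eq_subst sigma tau P Q :
  (forall X, proc_eq (sigma X) (tau X)) -> proc_eq P Q ->
  proc_eq (proc_subst sigma P) (proc_subst tau Q).
Proof. eauto using peq_trans, proc_eq_subst_l, proc_eq_subst_r. Qed.

(** * Heads and summands *)

(* If the body of a recursion exposes its own variable, as in mu X.X, unfolding
   never reaches a head. *)
Fixpoint proc_head (P : proc) : option proc :=
  match P with
  | PMu P =>
      match proc_head P with
      | Some (PVar 0) | None => None
      | Some H => Some (proc_subst (unfolding P) H)
      end
  | _ => Some P
  end.

Lemma proc_head_mu P H :
  proc_head (PMu P) = Some H ->
  exists H0, proc_head P = Some H0 /\ H0 <> PVar 0 /\ H = proc_subst (unfolding P) H0.
Proof.
  simpl. destruct (proc_head P) as [[| | | | |[|X]|]|]; try discriminate;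
    intros [= <-]; eexists; repeat split; discriminate.
Qed.

Lemma proc_head_ren f g P : proc_head (proc_ren f g P) = option_map (proc_ren f g) (proc_head P).
Proof.
  revert f g. induction P; intros f g; try reflexivity.
  simpl. rewrite IHP. destruct (proc_head P) as [H|]; [|reflexivity].
  pose proof (proc_ren_unfolding f g P H) as E.
  destruct H as [| | | | |[|X]|]; simpl in *; congruence.
Qed.

Lemma proc_head_subst sigma P :
  proc_head (proc_subst sigma P) =
  match proc_head P with
  | Some (PVar X) => proc_head (sigma X)
  | Some H => Some (proc_subst sigma H)
  | None => None
  end.
Proof.
  revert sigma. induction P; intros sigma; try reflexivity.
  simpl. rewrite IHP. destruct (proc_head P) as [H|]; [|reflexivity].
  pose proof (proc_subst_unfolding sigma P H) as E.
  destruct H as [| | | | |[|X]|]; simpl in *; try congruence.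
  clear E. rewrite proc_head_ren.
  destruct (proc_head (sigma X)) as [H|]; [|reflexivity].
  assert (E : proc_subst (unfolding (proc_subst (up_proc sigma) P))
                (proc_ren (fun x => x) S H) = H)
    by (rewrite proc_subst_ren; now apply proc_subst_id).
  destruct H; simpl in *; congruence.
Qed.

Lemma proc_head_unfold P : proc_head (proc_unfold P) = proc_head (PMu P).
Proof.
  change (proc_unfold P) with (proc_subst (unfolding P) P). rewrite proc_head_subst. simpl.
  destruct (proc_head P) as [[| | | | |[|X]|]|] eqn:E; try reflexivity.
  simpl. now rewrite E.
Qed.

Variant head_eq : proc -> proc -> Prop :=
| head_eq_in p l P P' : proc_eq P P' -> head_eq (PIn p l P) (PIn p l P')
| head_eq_out p l e P P' : proc_eq P P' -> head_eq (POut p l e P) (POut p l e P')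
| head_eq_plus P P' Q Q' : proc_eq P P' -> proc_eq Q Q' -> head_eq (PPlus P Q) (PPlus P' Q')
| head_eq_if e P P' Q Q' : proc_eq P P' -> proc_eq Q Q' -> head_eq (PIf e P Q) (PIf e P' Q')
| head_eq_mu P P' : proc_eq P P' -> head_eq (PMu P) (PMu P')
| head_eq_var X : head_eq (PVar X) (PVar X)
| head_eq_nil : head_eq PNil PNil.

Lemma head_eq_refl P : head_eq P P.
Proof. destruct P; constructor; apply peq_refl. Qed.

Lemma head_eq_sym P Q : head_eq P Q -> head_eq Q P.
Proof. destruct 1; constructor; now apply peq_sym. Qed.

Lemma head_eq_trans P Q R : head_eq P Q -> head_eq Q R -> head_eq P R.
Proof. destruct 1; inversion 1; subst; constructor; eauto using peq_trans. Qed.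

Lemma head_eq_subst sigma tau H H' :
  (forall X, proc_eq (sigma X) (tau X)) -> (forall X, H = PVar X -> head_eq (sigma X) (tau X)) ->
  head_eq H H' -> head_eq (proc_subst sigma H) (proc_subst tau H').
Proof.
  intros Hst Hvar E. destruct E; simpl; try (constructor; now apply proc_eq_subst).
  - constructor. apply proc_eq_subst; [now apply proc_eq_up_input|assumption].
  - constructor. apply proc_eq_subst; [now apply proc_eq_up_proc|assumption].
  - now apply Hvar.
Qed.

Definition heads_eq (H H' : option proc) : Prop :=
  match H, H' with
  | Some H, Some H' => head_eq H H'
  | None, None => True
  | _, _ => False
  end.

Lemma heads_eq_refl H : heads_eq H H.
Proof. destruct H; simpl; auto using head_eq_refl. Qed.

Lemma heads_eq_sym H H' : heads_eq H H' -> heads_eq H' H.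
Proof. destruct H, H'; simpl; auto using head_eq_sym. Qed.

Lemma heads_eq_trans H H' H'' : heads_eq H H' -> heads_eq H' H'' -> heads_eq H H''.
Proof. destruct H, H', H''; simpl; eauto using head_eq_trans; contradiction. Qed.

Lemma heads_eq_mu P P' :
  proc_eq P P' -> heads_eq (proc_head P) (proc_head P') ->
  heads_eq (proc_head (PMu P)) (proc_head (PMu P')).
Proof.
  intros E. simpl.
  destruct (proc_head P) as [H|], (proc_head P') as [H'|]; simpl; try contradiction; [|auto].
  intros EH.
  assert (Hunf : H <> PVar 0 ->
    head_eq (proc_subst (unfolding P) H) (proc_subst (unfolding P') H')).
  { intros Hne. apply head_eq_subst; [| |exact EH].
    - intros [|X]; [now apply peq_mu|apply peq_refl].
    - intros [|X] ->; [now elim Hne|constructor]. }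
  destruct EH as [| | | | |[|X]|]; try exact I; apply Hunf; discriminate.
Qed.

Lemma proc_eq_heads P Q : proc_eq P Q -> heads_eq (proc_head P) (proc_head Q).
Proof.
  induction 1 as [P|P|P Q _ IH|P Q R _ IHPQ _ IHQR| | | | |P P' E IH];
    try (simpl; constructor; assumption).
  - rewrite proc_head_unfold. apply heads_eq_refl.
  - apply heads_eq_refl.
  - now apply heads_eq_sym.
  - eauto using heads_eq_trans.
  - now apply heads_eq_mu.
Qed.

Lemma proc_eq_head P Q H :
  proc_eq P Q -> proc_head P = Some H -> exists H', proc_head Q = Some H' /\ head_eq H H'.
Proof.
  intros E HP. apply proc_eq_heads in E. rewrite HP in E.
  destruct (proc_head Q) as [H'|]; [eauto|contradiction].
Qed.

(* Recursions may sit between the sums. *)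
Inductive summand : proc -> participant -> label -> proc -> Prop :=
| summand_in P q l R : proc_head P = Some (PIn q l R) -> summand P q l R
| summand_plus_l P P1 P2 q l R :
    proc_head P = Some (PPlus P1 P2) -> summand P1 q l R -> summand P q l R
| summand_plus_r P P1 P2 q l R :
    proc_head P = Some (PPlus P1 P2) -> summand P2 q l R -> summand P q l R.

Lemma summand_proc_eq P P' q l R :
  summand P q l R -> proc_eq P P' -> exists R', summand P' q l R' /\ proc_eq R R'.
Proof.
  intros HR. revert P'.
  induction HR as [P q l R HP|P P1 P2 q l R HP _ IH|P P1 P2 q l R HP _ IH];
    intros P' E; destruct (proc_eq_head _ _ _ E HP) as [H' [HP' EH]];
    inversion EH as [? ? ? R' ER| |? P1' ? P2' E1 E2| | | |]; subst.
  - eauto using summand_in.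
  - destruct (IH _ E1) as [R' [HR' ER]]. eauto using summand_plus_l.
  - destruct (IH _ E2) as [R' [HR' ER]]. eauto using summand_plus_r.
Qed.

Lemma summand_subst sigma P q l R :
  summand P q l R -> summand (proc_subst sigma P) q l (proc_subst (up_input sigma) R).
Proof.
  induction 1 as [P q l R HP|P P1 P2 q l R HP _ IH|P P1 P2 q l R HP _ IH];
    pose proof (proc_head_subst sigma P) as Hs; rewrite HP in Hs.
  - now apply summand_in.
  - eapply summand_plus_l; eassumption.
  - eapply summand_plus_r; eassumption.
Qed.

Definition is_input (P : proc) : Prop := exists q l R, P = PIn q l R.

Definition receives (P : proc) : Prop :=
  match P with PIn _ _ _ | PPlus _ _ => True | _ => False end.

Lemma receives_head P : receives P -> proc_head P = Some P.
Proof. now destruct P. Qed.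

Lemma is_sum_receives P Ps : is_sum P Ps -> Forall is_input Ps -> receives P.
Proof.
  intros Hsum Hinput. destruct Hsum as [P|]; [|exact I].
  inversion Hinput as [|? ? [q [l [R ->]]] _]. exact I.
Qed.

Lemma is_sum_summand P Ps q l R : is_sum P Ps -> In (PIn q l R) Ps -> summand P q l R.
Proof.
  induction 1 as [P|P Q Ps Qs _ IHP _ IHQ]; intros HR.
  - destruct HR as [->|[]]. now apply summand_in.
  - apply in_app_or in HR. destruct HR as [HR|HR].
    + now apply (summand_plus_l _ P Q); [|apply IHP].
    + now apply (summand_plus_r _ P Q); [|apply IHQ].
Qed.

Lemma summand_is_sum P Ps q l R :
  is_sum P Ps -> Forall is_input Ps -> summand P q l R -> In (PIn q l R) Ps.
Proof.
  induction 1 as [P|P Q Ps Qs _ IHP _ IHQ]; intros Hinput HR.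
  - inversion Hinput as [|? ? [q' [l' [R' ->]]] _].
    inversion HR as [? ? ? ? E|? ? ? ? ? ? E|? ? ? ? ? ? E]; subst; inversion E; now left.
  - apply Forall_app in Hinput. destruct Hinput as [HPs HQs]. apply in_or_app.
    inversion HR as [? ? ? ? E|? ? ? ? ? ? E HRP|? ? ? ? ? ? E HRQ]; subst;
      inversion E; subst; auto.
Qed.

Lemma is_sum_map (f : proc -> proc) P Ps :
  (forall P Q, f (PPlus P Q) = PPlus (f P) (f Q)) -> is_sum P Ps -> is_sum (f P) (map f Ps).
Proof.
  intros Hf. induction 1; simpl; [constructor|].
  rewrite Hf, map_app. now constructor.
Qed.

(** * Typing under substitution *)

Lemma expr_typing_ren f G G' e s :
  (forall x s, nth_error G x = Some s -> nth_error G' (f x) = Some s) ->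
  expr_typing G e s -> expr_typing G' (expr_ren f e) s.
Proof. intros Hf. induction 1; simpl; eauto using expr_typing. Qed.

Lemma expr_typing_inv G e s :
  expr_typing G e s ->
  match e with
  | EVar x => exists s0, nth_error G x = Some s0 /\ subsort s0 s
  | EVal v => subsort (match v with VNat _ => SNat | VInt _ => SInt | VBool _ => SBool end) s
  | ESucc e => expr_typing G e SNat
  | ENeg e => expr_typing G e SInt
  | ENot e => expr_typing G e SBool
  | EChoice e1 e2 => expr_typing G e1 s /\ expr_typing G e2 s
  | EGt e1 e2 => expr_typing G e1 SInt /\ expr_typing G e2 SInt
  end.
Proof.
  induction 1 as [n|i|b|x s Hx| | | | | |e s s' _ IH Hs]; eauto using subsort_refl.
  destruct e; auto.
  - destruct IH as [s0 [Hx Hs0]]. eauto using subsort_trans.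
  - eauto using subsort_trans.
  - destruct IH. eauto using et_sub.
Qed.

Definition family_inputs (q : participant) (I : list (label * sort * proc * stype)) : list proc :=
  map (fun '(l, _, P, _) => PIn q l P) I.

Definition family_branches (I : list (label * sort * proc * stype)) : branches :=
  map (fun '(l, s, _, T) => (l, s, T)) I.

Lemma typing_in_family {A} (branch : A -> label * sort * stype) (body : A -> proc) G D q I Q :
  is_sum Q (map (fun i => PIn q (fst (fst (branch i))) (body i)) I) ->
  (forall i, In i I -> typing (snd (fst (branch i)) :: G) D (body i) (snd (branch i))) ->
  session_type (TIn q (map branch I)) ->
  typing G D Q (TIn q (map branch I)).
Proof.
  intros Hsum Hbody HT.
  set (J := map (fun i => (fst (branch i), body i, snd (branch i))) I).
  assert (EJ : map branch I = family_branches J).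
  { unfold family_branches, J. rewrite map_map. apply map_ext.
    intros i. now destruct (branch i) as [[l s] T]. }
  rewrite EJ in *. apply pt_in; [| |exact HT].
  - unfold J. rewrite map_map. erewrite map_ext; [exact Hsum|].
    intros i. simpl. now destruct (branch i) as [[l s] T].
  - intros l s P T HJ. apply in_map_iff in HJ. destruct HJ as [i [E Hi]].
    specialize (Hbody i Hi). destruct (branch i) as [[l0 s0] T0].
    injection E as <- <- <- <-. exact Hbody.
Qed.

Lemma typing_in_map (f h : proc -> proc) G D q I Q :
  (forall P Q, f (PPlus P Q) = PPlus (f P) (f Q)) ->
  (forall l P, f (PIn q l P) = PIn q l (h P)) ->
  is_sum Q (family_inputs q I) ->
  (forall l s P T, In (l, s, P, T) I -> typing (s :: G) D (h P) T) ->
  session_type (TIn q (family_branches I)) ->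
  typing G D (f Q) (TIn q (family_branches I)).
Proof.
  intros Hplus Hin Hsum Hbody HT.
  apply (typing_in_family (fun '(l, s, _, T) => (l, s, T)) (fun '(_, _, P, _) => h P));
    [| |exact HT].
  - apply (is_sum_map f) in Hsum; [|exact Hplus].
    unfold family_inputs in Hsum. rewrite map_map in Hsum. erewrite map_ext; [exact Hsum|].
    intros [[[l s] P] T]. symmetry. apply Hin.
  - intros [[[l s] P] T] Hi. exact (Hbody _ _ _ _ Hi).
Qed.

Lemma typing_ren f g G D G' D' P T :
  typing G D P T ->
  (forall x s, nth_error G x = Some s -> nth_error G' (f x) = Some s) ->
  (forall X U, nth_error D X = Some U -> nth_error D' (g X) = Some U) ->
  typing G' D' (proc_ren f g P) T.
Proof.
  intros HP. revert f g G' D'.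
  induction HP as [G D q I Q Hsum _ IH HT|G D|G D q l e P s T He _ IH
    |G D e P1 P2 T1 T2 T He _ IH1 _ IH2 HT12 HT|G D P T HT _ IH|G D X T HX
    |G D P T T' _ IH Hsub HT'|G D P Q T E _ IH]; intros f g G' D' Hf Hg; simpl.
  - apply (typing_in_map (proc_ren f g) (proc_ren (up_ren f) g)); auto.
    intros l s P T Hi. apply (IH _ _ _ _ Hi); [|exact Hg]. intros [|x]; simpl; auto.
  - constructor.
  - econstructor; eauto using expr_typing_ren.
  - econstructor; eauto using expr_typing_ren.
  - constructor; [exact HT|]. apply IH; auto. intros [|X]; simpl; auto.
  - constructor. auto.
  - eapply pt_sub; eauto.
  - eapply pt_eq; [|eauto]. now apply proc_eq_ren.
Qed.

Definition subst_typing (G : list sort) (D D' : list stype) (sigma : nat -> proc) : Prop :=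
  forall X T, nth_error D X = Some T -> typing G D' (sigma X) T.

Lemma subst_typing_up_input G D D' sigma s :
  subst_typing G D D' sigma -> subst_typing (s :: G) D D' (up_input sigma).
Proof. intros Hs X T HX. eapply typing_ren; eauto. Qed.

Lemma subst_typing_up_proc G D D' sigma T :
  subst_typing G D D' sigma -> subst_typing G (T :: D) (T :: D') (up_proc sigma).
Proof.
  intros Hs [|X] U HX; simpl in *; [now constructor|eapply typing_ren; eauto].
Qed.

Lemma subst_typing_unfolding G D P T :
  typing G D (PMu P) T -> subst_typing G (T :: D) D (unfolding P).
Proof. intros HP [|X] U HX; simpl in *; [now injection HX as <-|now constructor]. Qed.

Lemma typing_subst sigma G D D' P T :
  typing G D P T -> subst_typing G D D' sigma -> typing G D' (proc_subst sigma P) T.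
Proof.
  intros HP. revert sigma D'.
  induction HP as [G D q I Q Hsum _ IH HT|G D|G D q l e P s T He _ IH
    |G D e P1 P2 T1 T2 T He _ IH1 _ IH2 HT12 HT|G D P T HT _ IH|G D X T HX
    |G D P T T' _ IH Hsub HT'|G D P Q T E _ IH]; intros sigma D' Hs; simpl.
  - apply (typing_in_map (proc_subst sigma) (proc_subst (up_input sigma))); auto.
    intros l s P T Hi. apply (IH _ _ _ _ Hi). now apply subst_typing_up_input.
  - constructor.
  - econstructor; eauto.
  - econstructor; eauto.
  - constructor; [exact HT|]. now apply IH, subst_typing_up_proc.
  - now apply Hs.
  - eapply pt_sub; eauto.
  - eapply pt_eq; [|eauto]. now apply proc_eq_subst_l.
Qed.

(** * Inversion of typing at heads *)

Definition input_typing (G : list sort) (D : list stype) (P : proc) (T : stype) : Prop :=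
  exists q bs, type_head T (TIn q bs) /\
    forall l s' U, In (l, s', U) bs ->
      exists R s, summand P q l R /\ subsort s' s /\ typing (s :: G) D R U.

(* Heads are never recursions, and nothing is needed about variables. *)
Definition head_typing (G : list sort) (D : list stype) (H : proc) (T : stype) : Prop :=
  match H with
  | PIn _ _ _ | PPlus _ _ => input_typing G D H T
  | POut q l e P =>
      exists bs s U, type_head T (TOut q bs) /\ In (l, s, U) bs /\
        expr_typing G e s /\ typing G D P U
  | PIf e P1 P2 => expr_typing G e SBool /\ typing G D P1 T /\ typing G D P2 T
  | PNil => type_head T TEnd
  | PMu _ | PVar _ => True
  end.

Lemma input_typing_sub G D P T T' :
  input_typing G D P T -> subtype T T' -> session_type T' -> input_typing G D P T'.
Proof.
  intros [q [bs [HT Hbs]]] Hsub HT'.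
  destruct (subtype_root _ _ _ Hsub HT) as [U' [HU' Hroot]].
  inversion Hroot as [|? ? bs' Hbs'|]; subst.
  exists q, bs'. split; [exact HU'|]. intros l s2 U2 HU2.
  destruct (Hbs' _ _ _ HU2) as [s1 [U1 [HU1 [Hs Hsub12]]]].
  destruct (Hbs _ _ _ HU1) as [R [s [HR [Hs1 HRtyped]]]].
  exists R, s. split; [exact HR|]. split; [eauto using subsort_trans|].
  eapply pt_sub; eauto using session_type_in, session_type_head.
Qed.

Lemma head_typing_sub G D H T T' :
  head_typing G D H T -> subtype T T' -> session_type T' -> head_typing G D H T'.
Proof.
  destruct H as [q l P|q l e P|P Q|e P Q|P|X|]; simpl; intros HH Hsub HT';
    eauto using input_typing_sub.
  - destruct HH as [bs [s [U [HT [HU [He HP]]]]]].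
    destruct (subtype_root _ _ _ Hsub HT) as [W [HW Hroot]].
    inversion Hroot as [| |? ? bs' Hbs']; subst.
    destruct (Hbs' _ _ _ HU) as [s' [U' [HU' [Hs HUU']]]].
    exists bs', s', U'. repeat split; eauto using et_sub.
    eapply pt_sub; eauto using session_type_out, session_type_head.
  - destruct HH as [He [HP HQ]]. eauto using pt_sub.
  - destruct (subtype_root _ _ _ Hsub HH) as [W [HW Hroot]].
    now inversion Hroot; subst.
Qed.

Lemma input_typing_proc_eq G D P P' T :
  input_typing G D P T -> proc_eq P P' -> input_typing G D P' T.
Proof.
  intros [q [bs [HT Hbs]]] E. exists q, bs. split; [exact HT|].
  intros l s' U HU. destruct (Hbs _ _ _ HU) as [R [s [HR [Hs HRtyped]]]].
  destruct (summand_proc_eq _ _ _ _ _ HR E) as [R' [HR' ER]].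
  exists R', s. eauto using pt_eq.
Qed.

Lemma head_typing_head_eq G D H H' T :
  head_typing G D H T -> head_eq H H' -> head_typing G D H' T.
Proof.
  intros HH EH.
  destruct EH as [p l P P' E|p l e P P' E|P P' Q Q' EP EQ|e P P' Q Q' EP EQ| | |];
    simpl in *; auto.
  - eauto using input_typing_proc_eq, peq_in.
  - destruct HH as [bs [s [U [HT [HU [He HP]]]]]]. exists bs, s, U. eauto using pt_eq.
  - eauto using input_typing_proc_eq, peq_plus.
  - destruct HH as [He [HP HQ]]. eauto using pt_eq.
Qed.

Lemma input_typing_subst sigma G D D' P T :
  input_typing G D P T -> subst_typing G D D' sigma -> input_typing G D' (proc_subst sigma P) T.
Proof.
  intros [q [bs [HT Hbs]]] Hs. exists q, bs. split; [exact HT|].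
  intros l s' U HU. destruct (Hbs _ _ _ HU) as [R [s [HR [Hss HRtyped]]]].
  exists (proc_subst (up_input sigma) R), s.
  eauto 6 using summand_subst, typing_subst, subst_typing_up_input.
Qed.

Lemma head_typing_subst sigma G D D' H T :
  head_typing G D H T -> subst_typing G D D' sigma ->
  (forall X, H = PVar X -> head_typing G D' (sigma X) T) ->
  head_typing G D' (proc_subst sigma H) T.
Proof.
  intros HH Hs Hvar. destruct H as [q l P|q l e P|P Q|e P Q|P|X|]; simpl in *; auto.
  - exact (input_typing_subst _ _ _ _ _ _ HH Hs).
  - destruct HH as [bs [s [U [HT [HU [He HP]]]]]].
    exists bs, s, U. eauto using typing_subst.
  - exact (input_typing_subst _ _ _ _ _ _ HH Hs).
  - destruct HH as [He [HP HQ]]. eauto using typing_subst.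
Qed.

Lemma receives_head_typing G D P T :
  receives P -> head_typing G D P T <-> input_typing G D P T.
Proof. now destruct P. Qed.

Lemma family_inputs_are_inputs q I : Forall is_input (family_inputs q I).
Proof.
  apply Forall_map, Forall_forall. intros [[[l s] P] T] _. now exists q, l, P.
Qed.

Lemma head_typing_is_sum G D q I Q :
  is_sum Q (family_inputs q I) ->
  (forall l s P T, In (l, s, P, T) I -> typing (s :: G) D P T) ->
  head_typing G D Q (TIn q (family_branches I)).
Proof.
  intros Hsum Hbody. apply receives_head_typing.
  { exact (is_sum_receives _ _ Hsum (family_inputs_are_inputs q I)). }
  eexists q, _. split; [constructor|]. intros l s U HU.
  apply in_map_iff in HU. destruct HU as [[[[l0 s0] R] U0] [E Hi]]. injection E as -> -> ->.
  exists R, s. split; [|eauto using subsort_refl].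
  apply (is_sum_summand _ _ _ _ _ Hsum), in_map_iff. now exists (l, s, R, U).
Qed.

Lemma typing_head_inv G D P T H : typing G D P T -> proc_head P = Some H -> head_typing G D H T.
Proof.
  intros HP. revert H.
  induction HP as [G D q I Q Hsum Hbody _ HT|G D|G D q l e P s T He HP _
    |G D e P1 P2 T1 T2 T He HP1 _ HP2 _ HT12 HT|G D P T HT HP IH|G D X T HX
    |G D P T T' _ IH Hsub HT'|G D P Q T E _ IH]; intros H HH.
  - rewrite receives_head in HH
      by exact (is_sum_receives _ _ Hsum (family_inputs_are_inputs q I)).
    injection HH as <-. now apply head_typing_is_sum.
  - injection HH as <-. constructor.
  - injection HH as <-. exists [(l, s, T)], s, T.
    repeat split; [constructor|now left|exact He|exact HP].
  - injection HH as <-. destruct (type_union_subtype _ _ _ HT12).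
    repeat split; eauto using pt_sub.
  - destruct (proc_head_mu _ _ HH) as [H0 [HH0 [Hne ->]]].
    eapply head_typing_subst; [exact (IH _ HH0)|now apply subst_typing_unfolding, pt_mu|].
    intros [|X] ->; [now elim Hne|exact I].
  - injection HH as <-. exact I.
  - eapply head_typing_sub; eauto.
  - destruct (proc_eq_head _ _ _ (peq_sym _ _ E) HH) as [H' [HH' EH]].
    eapply head_typing_head_eq; [exact (IH _ HH')|now apply head_eq_sym].
Qed.

Lemma typing_if_inv G D e P Q T :
  typing G D (PIf e P Q) T -> expr_typing G e SBool /\ typing G D P T /\ typing G D Q T.
Proof. intros HPQ. exact (typing_head_inv _ _ _ _ _ HPQ eq_refl). Qed.

(** * Characteristic processes *)

(* Typable exactly when the sort of the variable just received is a subsort of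
   [s]. *)
Definition test (s : sort) : expr :=
  match s with
  | SNat => EGt (ESucc (EVar 0)) (EVal (VNat 0))
  | SInt => EGt (EVar 0) (EVal (VNat 0))
  | SBool => ENot (EVar 0)
  end.

Definition sample (s : sort) : expr :=
  match s with
  | SNat => EVal (VNat 0)
  | SInt => EVal (VInt 0)
  | SBool => EVal (VBool true)
  end.

Lemma subsort_nat_int : subsort SNat SInt.
Proof. apply rt_step. constructor. Qed.

Lemma test_typing G s : expr_typing (s :: G) (test s) SBool.
Proof.
  assert (Hzero : expr_typing (s :: G) (EVal (VNat 0)) SInt)
    by (eapply et_sub; [constructor|apply subsort_nat_int]).
  destruct s; simpl.
  - apply et_gt; [|exact Hzero].
    eapply et_sub; [|apply subsort_nat_int]. apply et_succ. now constructor.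
  - apply et_gt; [now constructor|exact Hzero].
  - apply et_not. now constructor.
Qed.

Lemma test_typing_inv G s s' u : expr_typing (s' :: G) (test s) u -> subsort s' s.
Proof.
  intros Htest.
  assert (Hvar : expr_typing (s' :: G) (EVar 0) s).
  { destruct s; apply expr_typing_inv in Htest.
    - exact (expr_typing_inv _ _ _ (proj1 Htest)).
    - exact (proj1 Htest).
    - exact Htest. }
  apply expr_typing_inv in Hvar. destruct Hvar as [s0 [[= <-] Hs]]. exact Hs.
Qed.

Lemma sample_typing G s : expr_typing G (sample s) s.
Proof. destruct s; constructor. Qed.

Lemma sample_typing_inv G s s' : expr_typing G (sample s) s' -> subsort s s'.
Proof. destruct s; apply expr_typing_inv. Qed.

Definition test_input (p : participant) (l : label) (s : sort) (P : proc) : proc :=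
  PIn p l (PIf (test s) P P).

Definition sample_output (p : participant) (l : label) (s : sort) (P : proc) : proc :=
  POut p l (sample s) P.

(* On the empty list the value is junk. *)
Fixpoint pjoin (op : proc -> proc -> proc) (Ps : list proc) : proc :=
  match Ps with
  | [] => PNil
  | [P] => P
  | P :: Ps => op P (pjoin op Ps)
  end.

Definition psum : list proc -> proc := pjoin PPlus.

Definition pchoice : list proc -> proc := pjoin (PIf (EVal (VBool true))).

Lemma pjoin_map (f : proc -> proc) op op' Ps :
  f PNil = PNil -> (forall P Q, f (op P Q) = op' (f P) (f Q)) ->
  f (pjoin op Ps) = pjoin op' (map f Ps).
Proof.
  intros Hnil Hop. induction Ps as [|P [|Q Ps] IH]; auto.
  change (f (op P (pjoin op (Q :: Ps))) = op' (f P) (pjoin op' (map f (Q :: Ps)))).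
  now rewrite Hop, IH.
Qed.

Lemma pjoin_ind (Good : proc -> Prop) op Ps :
  Good PNil -> (forall P Q, Good P -> Good Q -> Good (op P Q)) ->
  Forall Good Ps -> Good (pjoin op Ps).
Proof.
  intros Hnil Hop HPs. induction HPs as [|P Ps HP HPs IH]; [exact Hnil|].
  destruct Ps; [exact HP|]. now apply Hop.
Qed.

Lemma psum_is_sum Ps : Ps <> [] -> is_sum (psum Ps) Ps.
Proof.
  intros Hne. induction Ps as [|P [|Q Ps] IH]; [now elim Hne|constructor|].
  apply (is_sum_plus P (psum (Q :: Ps)) [P]); [constructor|]. now apply IH.
Qed.

Fixpoint char (T : stype) : proc :=
  match T with
  | TEnd => PNil
  | TIn p bs => psum (map (fun '(l, s, U) => test_input p l s (char U)) bs)
  | TOut p bs => pchoice (map (fun '(l, s, U) => sample_output p l s (char U)) bs)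
  | TMu T => PMu (char T)
  | TVar t => PVar t
  end.

Lemma test_input_ren f g p l s P :
  proc_ren f g (test_input p l s P) = test_input p l s (proc_ren (up_ren f) g P).
Proof. now destruct s. Qed.

Lemma sample_output_ren f g p l s P :
  proc_ren f g (sample_output p l s P) = sample_output p l s (proc_ren f g P).
Proof. now destruct s. Qed.

Lemma char_ren f g T : proc_ren f g (char T) = char (type_ren g T).
Proof.
  revert f g.
  induction T as [|p bs IH|p bs IH|T IH|t] using stype_nested_ind; intros f g; simpl.
  - reflexivity.
  - unfold psum. rewrite (pjoin_map _ _ PPlus) by reflexivity. rewrite !map_map. f_equal.
    apply map_ext_in. intros [[l s] U] Hb. rewrite test_input_ren, (IH _ Hb). reflexivity.
  - unfold pchoice. rewrite (pjoin_map _ _ (PIf (EVal (VBool true)))) by reflexivity.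
    rewrite !map_map. f_equal.
    apply map_ext_in. intros [[l s] U] Hb. rewrite sample_output_ren, (IH _ Hb). reflexivity.
  - now rewrite IH.
  - reflexivity.
Qed.

Lemma char_subst sigma T :
  proc_subst (fun t => char (sigma t)) (char T) = char (type_subst sigma T).
Proof.
  revert sigma.
  induction T as [|p bs IH|p bs IH|T IH|t] using stype_nested_ind; intros sigma; simpl.
  - reflexivity.
  - unfold psum. rewrite (pjoin_map _ _ PPlus) by reflexivity. rewrite !map_map. f_equal.
    apply map_ext_in. intros [[l s] U] Hb. simpl. rewrite <- (IH _ Hb).
    rewrite (proc_subst_ext _ (fun t => char (sigma t))); [reflexivity|].
    intros X. rewrite char_ren. now rewrite type_ren_id.
  - unfold pchoice. rewrite (pjoin_map _ _ (PIf (EVal (VBool true)))) by reflexivity.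
    rewrite !map_map. f_equal.
    apply map_ext_in. intros [[l s] U] Hb. simpl. now rewrite <- (IH _ Hb).
  - rewrite <- IH. f_equal. apply proc_subst_ext. intros [|t]; [reflexivity|apply char_ren].
  - reflexivity.
Qed.

Lemma char_unfold T : proc_unfold (char T) = char (type_unfold T).
Proof.
  unfold type_unfold. rewrite <- char_subst. apply proc_subst_ext. now intros [|t].
Qed.

Lemma char_head T U : type_head T U -> proc_eq (char T) (char U).
Proof.
  induction 1 as [| | |T U _ IH]; try apply peq_refl.
  eapply peq_trans; [apply peq_unfold|]. now rewrite char_unfold.
Qed.

Lemma char_guards t T : type_guards t T -> proc_guards t (char T).
Proof.
  revert t. induction T as [|p bs _|p bs _|T IH|u] using stype_nested_ind; intros t HT; simpl in *.
  - exact I.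
  - apply (pjoin_ind (proc_guards t)); simpl; auto.
    apply Forall_map, Forall_forall. now intros [[l s] U].
  - apply (pjoin_ind (proc_guards t)); simpl; auto.
    apply Forall_map, Forall_forall. now intros [[l s] U].
  - now apply IH.
  - exact HT.
Qed.

Lemma char_wf m k T : type_wf k T -> proc_wf m k (char T).
Proof.
  revert m k.
  induction T as [|p bs IH|p bs IH|T IH|t] using stype_nested_ind; intros m k HT; simpl.
  - exact I.
  - apply type_wf_in in HT. destruct HT as [_ Hbs].
    apply (pjoin_ind (proc_wf m k)); simpl; auto.
    apply Forall_map, Forall_forall. intros [[l s] U] Hb.
    pose proof (IH _ Hb (S m) k (Hbs _ Hb)) as HU.
    split; [|now split]. destruct s; simpl; repeat split; lia.
  - apply type_wf_out in HT. destruct HT as [_ Hbs].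
    apply (pjoin_ind (proc_wf m k)); simpl; auto.
    apply Forall_map, Forall_forall. intros [[l s] U] Hb.
    split; [now destruct s|exact (IH _ Hb _ _ (Hbs _ Hb))].
  - inversion HT; subst. split; [now apply char_guards|now apply IH].
  - now inversion HT.
Qed.

(** * Typing of characteristic processes *)

Lemma typing_out_family {A} (branch : A -> label * sort * stype) (P : A -> proc) G D q I :
  (forall i, In i I -> typing G D (P i) (TOut q [branch i])) ->
  session_type (TOut q (map branch I)) ->
  typing G D (pchoice (map P I)) (TOut q (map branch I)).
Proof.
  induction I as [|i [|j I] IH]; intros HP HT.
  - apply type_wf_out in HT. now destruct HT as [[Hne _] _].
  - apply HP. now left.
  - apply (pt_if _ _ _ (P i) (pchoice (map P (j :: I)))
      (TOut q [branch i]) (TOut q (map branch (j :: I)))); [constructor| | | |exact HT].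
    + apply HP. now left.
    + apply IH; [intros k Hk; apply HP; now right|].
      apply type_wf_out in HT. destruct HT as [[_ Hnd] Hbs].
      apply type_wf_out. split; [split; [discriminate|now inversion Hnd]|].
      intros b Hb. apply Hbs. now right.
    + eapply union_out; [constructor|constructor|]. now apply type_eq_refl.
Qed.

Lemma typing_test_input G D s P T :
  session_type T -> typing (s :: G) D P T -> typing (s :: G) D (PIf (test s) P P) T.
Proof.
  intros HT HP. eapply pt_if; [apply test_typing|exact HP|exact HP| |exact HT].
  apply union_idem; now apply type_eq_refl.
Qed.

Fixpoint env_subst (D : list stype) (t : nat) : stype :=
  match D, t with
  | [], _ => TVar t
  | T :: _, 0 => T
  | _ :: D, S u => env_subst D u
  end.

Lemma env_subst_nth_error D t : t < length D -> nth_error D t = Some (env_subst D t).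
Proof.
  revert t. induction D as [|T D IH]; intros [|t] Ht; simpl in *; try lia; [reflexivity|].
  apply IH. lia.
Qed.

Lemma session_type_env_subst D T :
  Forall session_type D -> type_wf (length D) T -> session_type (type_subst (env_subst D) T).
Proof.
  intros HD. apply type_wf_subst. intros t Ht. apply env_subst_nth_error in Ht.
  rewrite Forall_forall in HD. exact (HD _ (nth_error_In _ _ Ht)).
Qed.

Lemma char_typing G D T :
  Forall session_type D -> type_wf (length D) T ->
  typing G D (char T) (type_subst (env_subst D) T).
Proof.
  revert G D.
  induction T as [|p bs IH|p bs IH|T IH|t] using stype_nested_ind; intros G D HD HT;
    pose proof (session_type_env_subst D _ HD HT) as Hsession; simpl in *.
  - constructor.
  - apply type_wf_in in HT. destruct HT as [[Hne _] Hbs].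
    apply (typing_in_family (fun b => (fst b, type_subst (env_subst D) (snd b)))
      (fun '(l, s, U) => PIf (test s) (char U) (char U))); [| |exact Hsession].
    + erewrite map_ext; [apply psum_is_sum|now intros [[l s] U]].
      intros E. now apply map_eq_nil in E.
    + intros [[l s] U] Hb. apply typing_test_input.
      * exact (session_type_env_subst D U HD (Hbs _ Hb)).
      * exact (IH _ Hb _ _ HD (Hbs _ Hb)).
  - apply type_wf_out in HT. destruct HT as [_ Hbs].
    apply typing_out_family; [|exact Hsession].
    intros [[l s] U] Hb. constructor; [apply sample_typing|].
    exact (IH _ Hb _ _ HD (Hbs _ Hb)).
  - inversion HT; subst. apply pt_mu; [exact Hsession|].
    eapply pt_sub; [|apply type_eq_subtype, type_eq_unfold, Hsession|exact Hsession].
    rewrite type_unfold_subst_up.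
    apply (IH _ (TMu (type_subst (up_type (env_subst D)) T) :: D)); [|assumption].
    now constructor.
  - inversion HT; subst. constructor. now apply env_subst_nth_error.
Qed.

Lemma char_denotation T : session_type T -> denotation T (char T).
Proof.
  intros HT. split; [now apply char_wf|].
  rewrite <- (type_subst_id TVar T) at 2 by reflexivity.
  now apply (char_typing [] []).
Qed.

(** * Characteristic processes have least types *)

Definition char_subtype (T T' : stype) : Prop :=
  session_type T /\ session_type T' /\ exists G D, typing G D (char T) T'.

Definition char_inputs (p : participant) (bs : branches) : list proc :=
  map (fun '(l, s, U) => test_input p l s (char U)) bs.

Lemma is_sum_char_in p bs : bs <> [] -> is_sum (char (TIn p bs)) (char_inputs p bs).
Proof. intros Hne. apply psum_is_sum. intros E. now apply map_eq_nil in E. Qed.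

Lemma char_inputs_are_inputs p bs : Forall is_input (char_inputs p bs).
Proof. apply Forall_map, Forall_forall. intros [[l s] U] _. now do 3 eexists. Qed.

Lemma summand_char_in p bs q l R :
  bs <> [] -> summand (char (TIn p bs)) q l R ->
  q = p /\ exists s U, In (l, s, U) bs /\ R = PIf (test s) (char U) (char U).
Proof.
  intros Hne HR.
  apply (summand_is_sum _ _ _ _ _ (is_sum_char_in p bs Hne) (char_inputs_are_inputs p bs)) in HR.
  apply in_map_iff in HR. destruct HR as [[[l0 s] U] [[= <- <- <-] Hb]]. eauto.
Qed.

Lemma char_in_root G D p bs T' :
  session_type (TIn p bs) -> session_type T' -> typing G D (char (TIn p bs)) T' ->
  exists U', type_head T' U' /\ root_subtype char_subtype (TIn p bs) U'.
Proof.
  intros HT HT' Hchar. pose proof (proj1 (type_wf_in _ _ _) HT) as [[Hne _] _].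
  pose proof (is_sum_receives _ _ (is_sum_char_in p bs Hne) (char_inputs_are_inputs p bs))
    as Hreceives.
  pose proof (typing_head_inv _ _ _ _ _ Hchar (receives_head _ Hreceives)) as Hhead.
  apply (receives_head_typing _ _ _ _ Hreceives) in Hhead.
  destruct Hhead as [q [cs [Hcs Hbranches]]].
  pose proof (session_type_head _ _ Hcs HT') as Hcs_session.
  assert (q = p) as ->.
  { apply type_wf_in in Hcs_session. destruct Hcs_session as [[Hcs_ne _] _].
    destruct cs as [|[[l s] V] cs]; [now elim Hcs_ne|].
    destruct (Hbranches l s V) as [R [s' [HR _]]]; [now left|].
    now apply summand_char_in in HR. }
  exists (TIn p cs). split; [exact Hcs|]. constructor. intros l s' V' HV'.
  destruct (Hbranches _ _ _ HV') as [R [s0 [HR [Hs0 HRtyped]]]].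
  destruct (summand_char_in _ _ _ _ _ Hne HR) as [_ [s [V [HV ->]]]].
  apply typing_if_inv in HRtyped. destruct HRtyped as [Htest [HVtyped _]].
  exists s, V. split; [exact HV|].
  split; [eauto using subsort_trans, test_typing_inv|].
  split; [|split]; eauto using session_type_in.
Qed.

Lemma typing_pchoice_inv G D Ps T P : typing G D (pchoice Ps) T -> In P Ps -> typing G D P T.
Proof.
  induction Ps as [|Q [|R Ps] IH]; intros HPs HP.
  - destruct HP.
  - now destruct HP as [<-|[]].
  - apply typing_if_inv in HPs. destruct HPs as [_ [HQ HRPs]].
    destruct HP as [<-|HP]; auto.
Qed.

Lemma char_out_branch G D p bs T' l s U :
  typing G D (char (TOut p bs)) T' -> In (l, s, U) bs ->
  exists cs s' U', type_head T' (TOut p cs) /\ In (l, s', U') cs /\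
    subsort s s' /\ typing G D (char U) U'.
Proof.
  intros Hchar Hb.
  assert (Hout : typing G D (sample_output p l s (char U)) T').
  { apply (typing_pchoice_inv _ _ _ _ _ Hchar), in_map_iff. now exists (l, s, U). }
  destruct (typing_head_inv _ _ _ _ _ Hout eq_refl) as [cs [s' [U' [Hcs [HU' [Hsample HU]]]]]].
  exists cs, s', U'. eauto using sample_typing_inv.
Qed.

Lemma char_out_root G D p bs T' :
  session_type (TOut p bs) -> session_type T' -> typing G D (char (TOut p bs)) T' ->
  exists U', type_head T' U' /\ root_subtype char_subtype (TOut p bs) U'.
Proof.
  intros HT HT' Hchar. pose proof (proj1 (type_wf_out _ _ _) HT) as [[Hne _] _].
  assert (exists cs, type_head T' (TOut p cs)) as [cs Hcs].
  { destruct bs as [|[[l s] V] bs]; [now elim Hne|].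
    destruct (char_out_branch _ _ _ _ _ l s V Hchar) as [cs [_ [_ [Hcs _]]]]; [now left|eauto]. }
  exists (TOut p cs). split; [exact Hcs|]. constructor. intros l s V HV.
  destruct (char_out_branch _ _ _ _ _ _ _ _ Hchar HV) as [cs' [s' [V' [Hcs' [HV' [Hs HVtyped]]]]]].
  injection (type_head_det _ _ _ Hcs Hcs') as <-.
  exists s', V'. split; [exact HV'|]. split; [exact Hs|].
  split; [|split]; eauto using session_type_out, session_type_head.
Qed.

Lemma char_principal G D T T' :
  session_type T -> session_type T' -> typing G D (char T) T' -> subtype T T'.
Proof.
  intros HT HT' Hchar. apply (subtype_coind char_subtype); [|now split; [|split; [|exists G, D]]].
  clear. intros T T' [HT [HT' [G [D Hchar]]]].
  destruct (type_head_exists T HT) as [U HU].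
  pose proof (session_type_head _ _ HU HT) as HUsession.
  apply (pt_eq _ _ _ _ _ (char_head _ _ HU)) in Hchar.
  exists U. enough (exists U', type_head T' U' /\ root_subtype char_subtype U U')
    as [U' [HU' Hroot]] by eauto.
  pose proof (type_head_root _ _ HU) as Hroot.
  destruct U as [|p bs|p bs|U|t]; try contradiction.
  - exists TEnd. split; [exact (typing_head_inv _ _ _ _ _ Hchar eq_refl)|constructor].
  - now apply (char_in_root G D).
  - now apply (char_out_root G D).
Qed.

Theorem mainTheorem2 (T T' : stype) (hT : session_type T) (hT' : session_type T') :
  subtype T T' <-> (forall P : proc, denotation T P -> denotation T' P).
Proof.
  split.
  - intros Hsub P [Hclosed HP]. split; [exact Hclosed|]. eapply pt_sub; eauto.
  - intros Hincl. destruct (Hincl _ (char_denotation T hT)) as [_ Hchar].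
    exact (char_principal _ _ _ _ hT hT' Hchar).
Qed.
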